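(* Let $(V,E,\mu,w)$ be a weighted graph and let $\Omega$ be a finite connected subset of $V$. Let $\{p_i\}_{i=1}^\infty$ be any sequence with $p_i>1$ and $p_i\to 1$, and let $u_i$ be the normalized first eigenfunction of the Dirichlet $p_i$-Laplacian on $\Omega$. Then there exist a subsequence $\{p_{i_k}\}_k$, an integer $N\ge 1$, Cheeger cuts $A_1,\dots,A_N$ of $\Omega$ satisfying $A_N\subsetneq A_{N-1}\subsetneq\cdots\subsetneq A_1$, and constants $c_1,\dots,c_N>0$ such that, pointwise on $V$, $$\lim_{k\to\infty}u_{i_k}=\sum_{n=1}^N c_n\mathbf 1_{A_n},$$ where $\mathbf 1_{A_n}$ denotes the characteristic function of $A_n$.
   Context: A weighted graph $(V,E,\mu,w)$ consists of a simple, undirected, locally finite graph $(V,E)$, a vertex measure $\mu:V\to(0,\infty)$, $x\mapsto\mu_x$, and an edge measure $w:E\to(0,\infty)$, $\{x,y\}\mapsto w_{xy}=w_{yx}$. Write $x\sim y$ if $\{x,y\}\in E$. For a finite set $D\subset V$, $|D|_\mu=\sum_{x\in D}\mu_x$; for a finite set $F\subset E$, $|F|_w=\sum_{\{x,y\}\in F}w_{xy}$. A (nonempty) subset $\Omega\subset V$ is connected if any $x,y\in\Omega$ can be joined by a path $x=x_0\sim x_1\sim\cdots\sim x_k=y$ with all $x_i\in\Omega$. $C_0(\Omega)$ is the set of functions $u:V\to\mathbb R$ vanishing on $V\setminus\Omega$, and for $p\ge1$, $|u|_p=\left(\sum_{x\in\Omega}|u(x)|^p\mu_x\right)^{1/p}$.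 For $p>1$, the Dirichlet $p$-Laplacian on $\Omega$ is $$\Delta_pu(x)=\frac1{\mu_x}\sum_{y\in V:\,y\sim x}w_{xy}|u(y)-u(x)|^{p-2}(u(y)-u(x)),\quad x\in\Omega,\ u\in C_0(\Omega),$$ with the convention $|t|^{p-2}t=0$ for $t=0$. A pair $(\lambda,u)\in\mathbb R\times C_0(\Omega)$ with $u\ne0$ is an eigenvalue and eigenfunction if $-\Delta_pu(x)=\lambda|u(x)|^{p-2}u(x)$ for all $x\in\Omega$. The smallest eigenvalue is the first eigenvalue $\lambda_{1,p}(\Omega)$, and the associated eigenfunctions are the first eigenfunctions. For $\Omega$ finite and connected and $p>1$, it is known that first eigenfunctions have a fixed strict sign on $\Omega$ and are unique up to a nonzero multiplicative constant; the normalized first eigenfunction is the unique first eigenfunction $u$ with $u>0$ on $\Omega$ and $|u|_p=1$. For $D\subset V$, $\partial D=\{\{x,y\}\in E:x\in D,\ y\in V\setminus D\}$. The Cheeger constant of $\Omega$ is $h(\Omega)=\inf_{\emptyset\ne D\subset\Omega}\frac{|\partial D|_w}{|D|_\mu}$. A nonempty subset $D\subset\Omega$ is a Cheeger cut of $\Omega$ if $\frac{|\partial D|_w}{|D|_\mu}=h(\Omega)$. *)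

(* Defs.v *)
From HB Require Import structures.
From mathcomp Require Import all_boot all_order all_algebra finmap.
From mathcomp Require Import all_classical all_reals all_analysis.

Set Implicit Arguments.
Unset Strict Implicit.
Unset Printing Implicit Defensive.

Import Order.TTheory GRing.Theory Num.Theory.
Import numFieldNormedType.Exports.

Local Open Scope fset_scope.
Local Open Scope classical_set_scope.
Local Open Scope ring_scope.

(* Edges are unordered pairs, i.e. two-element finite sets of vertices; this
   makes the graph simple and the edge weights symmetric by construction. The
   value of [ewt] outside [edge] is irrelevant. *)
Record weighted_graph (R : realType) (V : choiceType) := WeightedGraph {
  edge : pred {fset V};
  vwt : V -> R;
  ewt : {fset V} -> R;
  edge_card : forall e, edge e -> #|` e| = 2%N;
  edge_locally_finite : forall x, finite_set [set y | edge [fset x; y]];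
  vwt_gt0 : forall x, 0 < vwt x;
  ewt_gt0 : forall e, edge e -> 0 < ewt e
}.

Section Graph.
Context {R : realType} {V : choiceType} (G : weighted_graph R V).
Implicit Types (D Omega : {fset V}) (u : V -> R) (p lambda : R).

Definition adj : rel V := fun x y => edge G [fset x; y].

Definition vmeasure D : R := \sum_(x <- D) vwt G x.

(* Finitely supported sum: it is the intended one when [F] is finite, as is
   the case for [eboundary D] by local finiteness. *)
Definition emeasure (F : set {fset V}) : R := \sum_(e \in F) ewt G e.

Definition connected_fset Omega : Prop :=
  Omega != fset0 /\
  forall x y, x \in Omega -> y \in Omega ->
    exists s : seq V, [/\ path adj x s, last x s = y & {subset s <= Omega}].

Definition C0 Omega : set (V -> R) :=
  [set u | forall x, x \notin Omega -> u x = 0].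

Definition pnorm Omega p u : R :=
  (\sum_(x <- Omega) `|u x| `^ p * vwt G x) `^ p^-1.

(* |t|^(p-2) t; it is 0 at t = 0 whatever the value of [0 `^ (p - 2)]. *)
Definition spow p (t : R) : R := `|t| `^ (p - 2) * t.

Definition plaplacian p u (x : V) : R :=
  (vwt G x)^-1 *
  \sum_(y \in [set y | adj x y]) ewt G [fset x; y] * spow p (u y - u x).

Definition eigenpair Omega p lambda u : Prop :=
  [/\ C0 Omega u, exists x, u x != 0 &
      forall x, x \in Omega -> - plaplacian p u x = lambda * spow p (u x)].

Definition eigenvalue Omega p lambda : Prop :=
  exists u, eigenpair Omega p lambda u.

Definition first_eigenvalue Omega p lambda : Prop :=
  eigenvalue Omega p lambda /\
  forall lambda', eigenvalue Omega p lambda' -> lambda <= lambda'.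

Definition first_eigenfunction Omega p u : Prop :=
  exists2 lambda, first_eigenvalue Omega p lambda & eigenpair Omega p lambda u.

Definition normalized_first_eigenfunction Omega p u : Prop :=
  [/\ first_eigenfunction Omega p u,
      forall x, x \in Omega -> 0 < u x &
      pnorm Omega p u = 1].

Definition eboundary D : set {fset V} :=
  [set e | edge G e /\
     exists x y, [/\ e = [fset x; y], x \in D & y \notin D]].

Definition cheeger_ratio D : R := emeasure (eboundary D) / vmeasure D.

Definition cheeger Omega : R :=
  inf [set cheeger_ratio D | D in [set D | D != fset0 /\ (D `<=` Omega)%fset]].

Definition cheeger_cut Omega D : Prop :=
  [/\ D != fset0, (D `<=` Omega)%fset & cheeger_ratio D = cheeger Omega].

End Graph.

(* Main.v *)
Require Import Defs.
From HB Require Import structures.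
From mathcomp Require Import all_boot all_order all_algebra finmap.
From mathcomp Require Import all_classical all_reals all_analysis.
From mathcomp Require Import ring lra.

Set Implicit Arguments.
Unset Strict Implicit.
Unset Printing Implicit Defensive.

Import Order.TTheory GRing.Theory Num.Theory.
Import numFieldNormedType.Exports.

Local Open Scope fset_scope.
Local Open Scope classical_set_scope.
Local Open Scope ring_scope.

(* Testing the eigenvalue equation of a positive eigenfunction [u] with
   [1_D u^(1-p)], [D `<=` Omega], and bounding each edge term as in Picone's
   inequality gives [lambda <= cheeger_ratio D], so [lambda_i <= h]; testing it
   with [u_i] itself gives [E_(p_i)(u_i) = lambda_i]. A pointwise limit [U]
   of a subsequence then has mass 1 and total variation at most [h]. By the
   coarea formula both quantities split over the superlevel sets of [U], each
   of which has perimeter at least [h] times its measure: all these inequalities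
   are equalities, and [U] is the layer-cake sum of its superlevel sets. *)

(** * Signed powers and the pointwise Picone bound *)

Section Spow.
Context {R : realType}.
Implicit Types p t a b : R.

Lemma spowN p t : spow p (- t) = - spow p t.
Proof. by rewrite /spow normrN mulrN. Qed.

Lemma spow_ge0E p t : 1 < p -> 0 <= t -> spow p t = t `^ (p - 1).
Proof.
move=> p1; rewrite le_eqVlt => /predU1P[<-|t0].
  by rewrite /spow mulr0 powR0// subr_eq0 gt_eqF.
rewrite /spow gtr0_norm// -{2}(powRr1 (ltW t0)) -powRD; last first.
  by rewrite (gt_eqF t0) implybT.
by congr (_ `^ _); ring.
Qed.

Lemma spow_mul p t : 1 < p -> spow p t * t = `|t| `^ p.
Proof.
move=> p1; wlog t0 : t / 0 <= t => [W|].
  have [/W//|/ltW t0] := leP 0 t.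
  by rewrite -(normrN t) -W ?oppr_ge0// spowN mulrNN.
rewrite spow_ge0E// ger0_norm// mulrC mulr_powRB1//; lra.
Qed.

Lemma spow_sub_le p a b : 1 < p -> 0 < a -> 0 <= b ->
  spow p (a - b) / a `^ (p - 1) <= 1.
Proof.
move=> p1 a0 b0; rewrite ler_pdivrMr ?powR_gt0// mul1r.
have [ab|ab] := leP b a.
  rewrite spow_ge0E ?subr_ge0//; apply: ge0_ler_powR; rewrite ?nnegrE; lra.
rewrite (le_trans _ (powR_ge0 _ _))// /spow pmulr_rle0; first lra.
by rewrite powR_gt0// normr_gt0; lra.
Qed.

(** The two factors have opposite signs: the first has the sign of [a - b], and the power [1 - p] is
    decreasing on positive reals. *)
Lemma spow_sub_inv_le0 p a b : 1 < p -> 0 < a -> 0 < b ->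
  spow p (a - b) * ((a `^ (p - 1))^-1 - (b `^ (p - 1))^-1) <= 0.
Proof.
move=> p1; wlog ab : a b / b <= a => [W a0 b0|a0 b0].
  have [ba|/ltW ab] := leP b a; first exact: W.
  by rewrite -opprB spowN mulNr -mulrN opprB W.
rewrite mulr_ge0_le0//; first by rewrite spow_ge0E ?subr_ge0// powR_ge0.
rewrite subr_le0 lef_pV2 ?posrE ?powR_gt0//.
by apply: ge0_ler_powR; rewrite ?nnegrE; lra.
Qed.

(* Picone's inequality for the test function [1_D]. *)
Lemma picone_indic p a b (da db : bool) : 1 < p -> 0 <= a -> 0 <= b ->
    (da -> 0 < a) -> (db -> 0 < b) ->
  spow p (a - b) * (da%:R / a `^ (p - 1) - db%:R / b `^ (p - 1))
    <= `|da%:R - db%:R|.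
Proof.
move=> p1 a0 b0; case: da => [/(_ isT) a1|_]; case: db => [/(_ isT) b1|_];
  rewrite ?mul0r ?mul1r ?subrr ?subr0 ?sub0r ?normrN ?normr0 ?mulr0 ?normr1//.
- exact: spow_sub_inv_le0.
- exact: spow_sub_le.
- by rewrite mulrN -mulNr -spowN opprB spow_sub_le.
Qed.

End Spow.

(** * Limits with varying exponents and diagonal extraction *)

(** For [l > 0] the power is [expR (p k * ln (v k))], continuous in both arguments. At [l = 0] the
    logarithm breaks down; instead, since [p k > 1], the power lies between 0 and [v k] once
    [v k < 1]. *)
Lemma cvg_powR_vary {R : realType} (p v : nat -> R) (l : R) :
    (forall k, 1 < p k) -> p @ \oo --> (1 : R) ->
    (forall k, 0 <= v k) -> v @ \oo --> l ->
  (fun k => v k `^ p k) @ \oo --> l.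
Proof.
move=> p1 pc v0 vl.
have : 0 <= l by apply: (cvgr_to_ge vl); exact: nearW.
rewrite le_eqVlt => /predU1P[l0|l0]; last first.
  have pv : \forall k \near \oo, expR (p k * ln (v k)) = v k `^ p k.
    near=> k; rewrite /powR gt_eqF//.
    by near: k; exact: (cvgr_gt l).
  apply: cvg_trans; first exact: near_eq_cvg pv.
  have pl : (fun k => p k * ln (v k)) @ \oo --> 1 * ln l.
    by apply: cvgM => //; apply: continuous_cvg => //; exact: continuous_ln.
  have : (fun k => expR (p k * ln (v k))) @ \oo --> expR (1 * ln l).
    by apply: continuous_cvg pl; exact: continuous_expR.
  by rewrite mul1r lnK.
rewrite -l0 in vl *.
apply: (squeeze_cvgr _ (cvg_cst (0 : R)) vl).
near=> k; rewrite powR_ge0/=.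
have : v k < 1 by near: k; exact: (cvgr_lt 0).
have := v0 k; rewrite le_eqVlt => /predU1P[<- _|vk0 vk1].
  by rewrite powR0// gt_eqF// (lt_trans _ (p1 k)).
by rewrite ge1r_powR// ?vk0 ltW.
Unshelve. all: by end_near. Qed.

Lemma increasing_seq_cvgn (s : nat -> nat) : {homo s : j k / (j < k)%N} ->
  s @ \oo --> \oo.
Proof.
move=> sinc; have sge k : (k <= s k)%N.
  by elim: k => // k /leq_ltn_trans; apply; exact: sinc.
move=> A [N _ NA]; exists N => // k /= Nk.
exact/NA/(leq_trans Nk (sge k)).
Qed.

(** Induction on [l]: a further subsequence makes the values at the new point converge and keeps the
    limits already obtained. *)
Lemma bolzano_weierstrass_seq {R : realType} (V : eqType) (l : seq V)
    (f : nat -> V -> R) :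
    (forall x, x \in l -> bounded_fun (f ^~ x)) ->
  exists s : nat -> nat, {homo s : j k / (j < k)%N} /\
    forall x, x \in l -> cvgn (fun k => f (s k) x).
Proof.
elim: l f => [|a l IH] f bf; first by exists id; split.
have [|s [sinc sl]] := IH f; first by move=> x xl; apply: bf; rewrite inE xl orbT.
have [|t tinc tc] := @bolzano_weierstrass R (fun k => f (s k) a).
  have [M [Mr Mf]] := bf a (mem_head _ _).
  exists M; split => // y /Mf yM k _; exact: yM.
have tinc' : {homo t : j k / (j < k)%N} .
  by move=> j k jk; have := leW_mono tinc j k; rewrite !ltEnat/= jk.
exists (s \o t); split => [j k jk|x]; first exact/sinc/tinc'.
rewrite inE => /predU1P[->//|/sl/cvg_ex[/= y xy]].
apply/cvg_ex; exists y; apply: (@cvg_comp _ _ _ t (fun k => f (s k) x)).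
  exact: increasing_seq_cvgn.
exact: xy.
Qed.

(** * Edge sums, Green's formula and perimeters *)

Section Energy.
Context {R : realType} {V : choiceType} (G : weighted_graph R V).
Implicit Types (D Omega S : {fset V}) (u f : V -> R) (p : R).

(** Extending the weight by 0 to non-adjacent pairs turns sums over edges into plain double sums. *)
Definition adjwt (x y : V) : R := if adj G x y then ewt G [fset x; y] else 0.

Lemma adjC x y : adj G x y = adj G y x.
Proof. by rewrite /adj fsetUC. Qed.

Lemma adjwtC x y : adjwt x y = adjwt y x.
Proof. by rewrite /adjwt adjC fsetUC. Qed.

Lemma adjwt_ge0 x y : 0 <= adjwt x y.
Proof. by rewrite /adjwt; case: ifP => // /ewt_gt0 /ltW. Qed.

(** A finite window [S] holding both ends of every edge that meets [Omega], so that boundary edges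
    are counted although [V] may be infinite. *)
Definition contains_nbhd Omega S :=
  (Omega `<=` S)%fset /\ forall x y, x \in Omega -> adj G x y -> y \in S.

Lemma contains_nbhd_ex Omega : exists S, contains_nbhd Omega S.
Proof.
pose N := [set` Omega] `|` \bigcup_(x in [set` Omega]) [set y | adj G x y].
have fN : finite_set N.
  rewrite finite_setU; split => //; apply: bigcup_finite => // x _.
  exact: edge_locally_finite.
exists (fset_set N); split; first by
  apply/fsubsetP => x xO; rewrite in_fset_set// inE; left.
by move=> x y xO xy; rewrite in_fset_set// inE; right; exists x.
Qed.

(* Every edge is counted twice, once in each direction. *)
Definition edge_sum S (F : V -> V -> R) : R :=
  \sum_(x <- S) \sum_(y <- S) adjwt x y * F x y.

Lemma edge_sumC S F : edge_sum S F = edge_sum S (fun x y => F y x).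
Proof.
rewrite /edge_sum exchange_big/=; apply: eq_bigr => x _.
by apply: eq_bigr => y _; rewrite adjwtC.
Qed.

Lemma edge_sumD S F F' :
  edge_sum S (fun x y => F x y + F' x y) = edge_sum S F + edge_sum S F'.
Proof.
rewrite /edge_sum -big_split/=; apply: eq_bigr => x _.
by rewrite -big_split/=; apply: eq_bigr => y _; rewrite mulrDr.
Qed.

Lemma ler_edge_sum S F F' :
    (forall x y, x \in S -> y \in S -> F x y <= F' x y) ->
  edge_sum S F <= edge_sum S F'.
Proof.
move=> FF'; rewrite /edge_sum big_seq [leRHS]big_seq; apply: ler_sum => x xS.
rewrite big_seq [leRHS]big_seq; apply: ler_sum => y yS.
by rewrite ler_wpM2l ?adjwt_ge0// FF'.
Qed.

Lemma eq_edge_sum S F F' : (forall x y, F x y = F' x y) ->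
  edge_sum S F = edge_sum S F'.
Proof.
by move=> FF'; apply: eq_bigr => x _; apply: eq_bigr => y _; rewrite FF'.
Qed.

Lemma plaplacianE Omega S p u x : contains_nbhd Omega S -> x \in Omega ->
  - plaplacian G p u x * vwt G x =
  \sum_(y <- S) adjwt x y * spow p (u x - u y).
Proof.
move=> [OS NS] xO; rewrite /plaplacian mulNr mulrAC mulVf ?mul1r; last first.
  by rewrite gt_eqF ?vwt_gt0.
rewrite (eq_fsbigr (fun y => adjwt x y * - spow p (u x - u y))); last first.
  by move=> y /set_mem/= xy; rewrite /adjwt xy -spowN opprB.
rewrite (fsbig_fwiden S); last 3 first.
- by move=> y; exact: NS.
- exact: fset_uniq.
- by move=> y [_ /= /negP/negbTE xy]; rewrite /adjwt xy mul0r.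
by rewrite -sumrN; apply: eq_bigr => y _; rewrite mulrN opprK.
Qed.

(** Green's formula: the sum is written over ordered pairs and added to its copy with [x] and [y]
    exchanged; [spow p] being odd, [f x] becomes [f x - f y]. The factor 2 reflects the double count
    of edges. *)
Lemma sum_plaplacian_mul Omega S p u f : contains_nbhd Omega S ->
    C0 Omega f ->
  2 * \sum_(x <- Omega) - plaplacian G p u x * f x * vwt G x =
  edge_sum S (fun x y => spow p (u x - u y) * (f x - f y)).
Proof.
move=> OS f0.
have -> : \sum_(x <- Omega) - plaplacian G p u x * f x * vwt G x =
    edge_sum S (fun x y => spow p (u x - u y) * f x).
  rewrite /edge_sum -(big_fset_incl _ OS.1) => [|x _ xO]; last first.
    by apply: big1 => y _; rewrite f0// !mulr0.
  apply: eq_big_seq => x xO.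
  rewrite mulrAC (plaplacianE _ _ OS xO) mulr_suml.
  by apply: eq_bigr => y _; rewrite mulrA.
rewrite mulr_natl mulr2n {2}edge_sumC -edge_sumD; apply: eq_edge_sum => x y.
by rewrite -(opprB (u x) (u y)) spowN; ring.
Qed.

(** A boundary edge has exactly one orientation leaving [D], selected by [F]; the absolute
    difference of indicators is [F x y + F y x]. *)
Lemma perimeterE Omega S D : contains_nbhd Omega S -> (D `<=` Omega)%fset ->
  edge_sum S (fun x y => `|(x \in D)%:R - (y \in D)%:R|) =
  2 * emeasure G (eboundary G D).
Proof.
move=> [OS NS] DO.
pose F (x y : V) : R := (x \in D)%:R * (y \notin D)%:R.
transitivity (edge_sum S (fun x y => F x y + F y x)).
  apply: eq_edge_sum => x y; rewrite /F.
  by case: (x \in D); case: (y \in D);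
    rewrite /= ?(subrr, subr0, sub0r, normrN, normr0, normr1) /=; ring.
rewrite edge_sumD [X in _ + X]edge_sumC.
suff -> : emeasure G (eboundary G D) = edge_sum S F.
  by rewrite mulr_natl mulr2n.
pose P := [set z : V * V | [/\ adj G z.1 z.2, z.1 \in D & z.2 \notin D]].
have -> : eboundary G D = (fun z => [fset z.1; z.2]) @` P.
  apply/seteqP; split => [e [Ge [x [y [exy xD yD]]]]|_ [[x y] /= [xy xD yD] <-]].
    by exists (x, y) => //; split => //=; rewrite /adj -exy.
  by split => //; exists x, y.
rewrite /emeasure fsbig_image; last first.
  (* An unordered boundary edge determines its outgoing pair, since only one of its ends lies in
     [D]. *)
  move=> [x y] [x' y'] /set_mem[/= _ xD yD] /set_mem[/= _ xD' yD'] /fsetP e.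
  have := e x; have := e y; rewrite !inE !eqxx ?orbT/=.
  have neq a b : a \in D -> b \notin D -> (a == b) = false.
    by move=> aD; apply: contraNF => /eqP <-.
  rewrite (eq_sym y x') (neq _ _ xD' yD) (neq _ _ xD yD') orbF/=.
  by move=> /esym/eqP <- /esym/eqP <-.
rewrite (eq_fsbigr (fun z => adjwt z.1 z.2 * F z.1 z.2)); last first.
  move=> [x y] /set_mem[/= xy xD yD].
  by rewrite /F /adjwt xy xD yD !mulr1.
rewrite (fsbig_fwiden [seq (x, y) | x <- S, y <- S]); last 3 first.
- move=> [x y] [/= xy xD yD]; have xO := fsubsetP DO _ xD.
  by apply/allpairsP; exists (x, y); split => //=;
    [exact: (fsubsetP OS)|exact: NS xy].
- by apply: allpairs_uniq; rewrite ?fset_uniq// => -[? ?] [? ?].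
- move=> [x y] [_ /= nP]; rewrite /adjwt /F.
  case: ifPn => [xy|_]; last by rewrite mul0r.
  have [xD|] := boolP (x \in D); last by rewrite mul0r mulr0.
  by have [|yD] := boolP (y \in D); [rewrite /= !mulr0|case: nP].
by rewrite big_allpairs.
Qed.

Lemma vmeasure_gt0 D : D != fset0 -> 0 < vmeasure G D.
Proof.
move=> /fset0Pn[x xD]; rewrite /vmeasure (big_fsetD1 x)//=.
by rewrite ltr_pwDl ?vwt_gt0// sumr_ge0// => y _; rewrite ltW ?vwt_gt0.
Qed.

Lemma emeasure_ge0 D : 0 <= emeasure G (eboundary G D).
Proof. by apply: fsumr_ge0 => e [/ewt_gt0/ltW]. Qed.

Lemma cheeger_le_ratio Omega D : D != fset0 -> (D `<=` Omega)%fset ->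
  cheeger G Omega <= cheeger_ratio G D.
Proof.
move=> D0 DO; apply: ge_inf; last by exists D.
(* An infimum in the reals is a lower bound only if the set is bounded below; 0 serves. *)
exists 0 => _ [C [C0 _] <-].
by rewrite divr_ge0 ?emeasure_ge0// ltW ?vmeasure_gt0.
Qed.

End Energy.

(** * Eigenvalue bound and energy identity *)

Section PositiveEigenfunctions.
Context {R : realType} {V : choiceType} (G : weighted_graph R V).
Variables (Omega S : {fset V}) (p lambda : R) (u : V -> R).
Hypotheses (p1 : 1 < p) (OS : contains_nbhd G Omega S).
Hypotheses (eigu : eigenpair G Omega p lambda u)
  (u_gt0 : forall x, x \in Omega -> 0 < u x).

Lemma eigenfunction_ge0 x : 0 <= u x.
Proof.
have [u0 _ _] := eigu.
by have [/u_gt0/ltW//|/u0 ->] := boolP (x \in Omega).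
Qed.

(** The denominator of the test function [f] cancels the power of [u] in the equation, leaving
    [lambda * vmeasure G D]; Green's formula and Picone's bound on each edge then give the
    perimeter. *)
Lemma eigenvalue_le_cheeger_ratio D : D != fset0 -> (D `<=` Omega)%fset ->
  lambda <= cheeger_ratio G D.
Proof.
move=> D0 DO; have [_ _ eqn] := eigu.
rewrite /cheeger_ratio ler_pdivlMr ?vmeasure_gt0//.
pose f x := (x \in D)%:R / u x `^ (p - 1).
rewrite -(ler_pM2l (ltr0n R 2)) -(perimeterE OS DO).
have -> : lambda * vmeasure G D =
    \sum_(x <- Omega) - plaplacian G p u x * f x * vwt G x.
  rewrite /vmeasure mulr_sumr.
  rewrite -(big_fset_incl _ DO) => [|x _ /negbTE xD]; last first.
    by rewrite /f xD !mul0r mulr0 mul0r.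
  apply: eq_big_seq => x xD; have xO := fsubsetP DO _ xD.
  rewrite eqn// /f xD div1r spow_ge0E ?eigenfunction_ge0// mulfK//.
  by rewrite gt_eqF// powR_gt0// u_gt0.
rewrite (sum_plaplacian_mul _ _ OS) => [|x xO]; last first.
  by rewrite /f (contraNF (fsubsetP DO x) xO) mul0r.
apply: ler_edge_sum => x y _ _.
by apply: picone_indic; rewrite ?eigenfunction_ge0// => /(fsubsetP DO)/u_gt0.
Qed.

Lemma eigenvalue_le_cheeger : Omega != fset0 -> lambda <= cheeger G Omega.
Proof.
move=> O0; apply: lb_le_inf; first by exists (cheeger_ratio G Omega), Omega.
by move=> _ [D [D0 DO] <-]; exact: eigenvalue_le_cheeger_ratio.
Qed.

Lemma eigenvalue_energy :
  edge_sum G S (fun x y => `|u x - u y| `^ p) =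
  2 * (lambda * \sum_(x <- Omega) `|u x| `^ p * vwt G x).
Proof.
have [u0 _ eqn] := eigu.
rewrite mulr_sumr; transitivity
  (2 * \sum_(x <- Omega) - plaplacian G p u x * u x * vwt G x).
  rewrite (sum_plaplacian_mul _ _ OS)//.
  by apply: eq_edge_sum => x y; rewrite spow_mul.
congr (_ * _); apply: eq_big_seq => x xO.
by rewrite eqn// -mulrA -(spow_mul _ p1) !mulrA.
Qed.

End PositiveEigenfunctions.

(** * Layer-cake decomposition *)

Section LayerCake.
Context {R : realType} {V : choiceType}.
Variables (Omega : {fset V}) (U : V -> R).
Hypotheses (U_ge0 : forall x, 0 <= U x) (U_C0 : C0 Omega U).

(** The leading 0 in [t] is the ground level, so that [t 1 < t 2 < ...] are the positive values of
    [U]. Only the indices from 1 to [size s] give genuine layers [A n]. *)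
Let s := sort <=%R (undup [seq U x | x <- Omega & 0 < U x]).
Let t n := nth 0 (0 :: s) n.
Let A n := [fset x in Omega | t n <= U x].

Let mem_s r : (r \in s) = [exists x : Omega, (0 < U (val x)) && (U (val x) == r)].
Proof.
rewrite mem_sort mem_undup; apply/mapP/existsP => [[x]|[x /andP[Ux /eqP Uxr]]].
  rewrite mem_filter => /andP[Ux xO] ->.
  by exists [` xO]; rewrite Ux eqxx.
by exists (val x) => //; rewrite mem_filter Ux fsvalP.
Qed.

Let t_sorted : sorted <%R (0 :: s).
Proof.
rewrite /= lt_path_sortedE sort_lt_sorted undup_uniq andbT.
by apply/allP => r; rewrite mem_s => /existsP[x /andP[+ /eqP <-]].
Qed.

Let lt_t i j : (i <= size s)%N -> (j <= size s)%N -> (t i < t j) = (i < j)%N.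
Proof. by move=> iN jN; rewrite /t lt_sorted_ltn_nth// inE ltnS. Qed.

Let le_t i j : (i <= size s)%N -> (j <= size s)%N -> (t i <= t j) = (i <= j)%N.
Proof. by move=> iN jN; rewrite leNgt lt_t// -leqNgt. Qed.

Let U_t x : exists2 m, (m <= size s)%N & U x = t m.
Proof.
have := U_ge0 x; rewrite le_eqVlt => /predU1P[<-|Ux]; first by exists 0%N.
have xO : x \in Omega by apply: contraTT Ux => /U_C0 ->; rewrite ltxx.
have /(nthP 0)[i iN Ei] : U x \in s.
  by rewrite mem_s; apply/existsP; exists [` xO]; rewrite Ux eqxx.
by exists i.+1.
Qed.

(** The coefficients are the gaps between consecutive levels. Each level is attained, so the layers
    are nonempty and strictly nested. *)
Lemma layer_cake : exists (N : nat) (A : nat -> {fset V}) (c : nat -> R),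
  [/\ forall n, (1 <= n <= N)%N ->
        [/\ A n != fset0, (A n `<=` Omega)%fset & 0 < c n],
      forall n, (1 <= n < N)%N -> (A n.+1 `<` A n)%fset,
      forall n x y, (1 <= n <= N)%N -> U x <= U y -> x \in A n -> y \in A n &
      forall x, U x = \sum_(1 <= n < N.+1) c n * (x \in A n)%:R].
Proof.
have tV n : (1 <= n <= size s)%N -> exists2 x, x \in Omega & U x = t n.
  case: n => // n /= nN; have : t n.+1 \in s by rewrite /t /= mem_nth.
  by rewrite mem_s => /existsP[x /andP[_ /eqP Ux]]; exists (val x); rewrite ?fsvalP.
have t_gt0 n : (1 <= n <= size s)%N -> 0 < t n.
  by move=> /andP[n1 nN]; rewrite -[0]/(t 0) lt_t.
have memA n x : (1 <= n <= size s)%N -> (x \in A n) = (t n <= U x).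
  move=> /t_gt0 tn; rewrite !inE/=.
  have [//|/U_C0 ->] := boolP (x \in Omega).
  by rewrite /= leNgt tn.
exists (size s), A, (fun n => t n - t n.-1); split.
- move=> n nN; have [x xO Ux] := tV n nN; split.
  + by apply/fset0Pn; exists x; rewrite memA// Ux.
  + by apply/fsubsetP => y; rewrite !inE => /andP[].
  + move: nN => /andP[n1 nN]; rewrite subr_gt0 lt_t ?prednK//.
    exact: leq_trans (leq_pred _) nN.
- move=> n /andP[n1 nN]; have [|x xO Ux] := tV n; first by rewrite n1 ltnW.
  have n1N : (1 <= n.+1 <= size s)%N by rewrite nN.
  have n0N : (1 <= n <= size s)%N by rewrite n1 ltnW.
  rewrite fproperE; apply/andP; split; last first.
    by apply/fsubsetPn; exists x; rewrite memA// Ux// -ltNge lt_t// ltnW.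
  apply/fsubsetP => y; rewrite !memA//; apply: le_trans.
  by rewrite le_t// ltnW.
- by move=> n x y nN xy; rewrite !memA// => /le_trans; apply.
- move=> x; have [m mN Um] := U_t x.
  (* From [t 0 = 0] the gaps telescope to [t m]; those kept are exactly those of the layers
     containing [x]. *)
  transitivity (\sum_(0 <= i < m) (t i.+1 - t i)).
    by rewrite telescope_sumr// Um subr0.
  rewrite (big_nat_widen _ _ _ _ _ mN) big_mkcond big_add1/=.
  apply: eq_big_nat => i /= iN; rewrite memA// Um le_t//.
  by case: ifP => _; rewrite ?mulr1 ?mulr0.
Qed.

End LayerCake.

(** * Coarea formula and the equality case *)

Section Coarea.
Context {R : realType} {V : choiceType} (G : weighted_graph R V).
Variables (Omega S : {fset V}) (U : V -> R).
Hypothesis OS : contains_nbhd G Omega S.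
Variables (N : nat) (A : nat -> {fset V}) (c : nat -> R).
Hypothesis A_sub : forall n, (1 <= n <= N)%N ->
  [/\ A n != fset0, (A n `<=` Omega)%fset & 0 < c n].
Hypothesis A_level : forall n x y,
  (1 <= n <= N)%N -> U x <= U y -> x \in A n -> y \in A n.
Hypothesis UE : forall x, U x = \sum_(1 <= n < N.+1) c n * (x \in A n)%:R.

Lemma vmeasure_layers : \sum_(x <- Omega) U x * vwt G x =
  \sum_(1 <= n < N.+1) c n * vmeasure G (A n).
Proof.
under eq_bigr do rewrite UE mulr_suml.
rewrite exchange_big/=; apply: eq_big_nat => n nN.
have [_ AO _] := A_sub nN.
rewrite /vmeasure mulr_sumr -(big_fset_incl _ AO) => [|x _ /negbTE ->]; last first.
  by rewrite mulr0 mul0r.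
by apply: eq_big_seq => x ->; rewrite mulr1.
Qed.

(** Superlevel sets are monotone along [U], so at a given pair all the indicator differences have
    the same sign and the absolute value passes inside the sum. *)
Lemma coarea : edge_sum G S (fun x y => `|U x - U y|) =
  2 * \sum_(1 <= n < N.+1) c n * emeasure G (eboundary G (A n)).
Proof.
have absE x y : `|U x - U y| =
    \sum_(1 <= n < N.+1) c n * `|(x \in A n)%:R - (y \in A n)%:R|.
  wlog xy : x y / U x <= U y => [W|].
    have [/W//|/ltW/W] := leP (U x) (U y).
    by rewrite distrC => ->; apply: eq_bigr => n _; rewrite distrC.
  rewrite distrC ger0_norm ?subr_ge0// (UE x) (UE y) -sumrB.
  apply: eq_big_nat => n nN; rewrite -mulrBr distrC ger0_norm// subr_ge0.
  have := A_level nN xy.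
  by case: (x \in A n) => [->//|_]; rewrite ler0n.
transitivity (\sum_(1 <= n < N.+1) c n * edge_sum G S
    (fun x y => `|(x \in A n)%:R - (y \in A n)%:R|)).
  under eq_bigr do rewrite mulr_sumr; rewrite exchange_big; apply: eq_bigr => x _.
  under eq_bigr do rewrite mulr_sumr; rewrite exchange_big; apply: eq_bigr => y _.
  by rewrite absE mulr_sumr; apply: eq_bigr => n _; rewrite mulrCA.
rewrite mulr_sumr; apply: eq_big_nat => n nN; have [_ AO _] := A_sub nN.
by rewrite (perimeterE OS AO) mulrCA.
Qed.

(** The weighted excess [g n] of each layer over the Cheeger bound is nonnegative, while the
    hypothesis makes the total nonpositive; hence every excess vanishes. *)
Lemma layers_cheeger_cut :
    edge_sum G S (fun x y => `|U x - U y|) <=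
      2 * (cheeger G Omega * \sum_(x <- Omega) U x * vwt G x) ->
  forall n, (1 <= n <= N)%N -> cheeger_cut G Omega (A n).
Proof.
rewrite coarea vmeasure_layers ler_pM2l// mulr_sumr -subr_le0 -sumrB => le0.
pose g n := c n * emeasure G (eboundary G (A n)) -
  cheeger G Omega * (c n * vmeasure G (A n)).
have gE n : (1 <= n <= N)%N -> g n = c n * vmeasure G (A n) *
    (cheeger_ratio G (A n) - cheeger G Omega).
  move=> /A_sub[A0 _ _]; rewrite /g /cheeger_ratio.
  by field; rewrite gt_eqF ?vmeasure_gt0.
have g_ge0 n : (1 <= n < N.+1)%N && true -> 0 <= g n.
  rewrite andbT => nN; have [A0 AO c0] := A_sub nN.
  by rewrite gE// mulr_ge0 ?subr_ge0 ?cheeger_le_ratio// mulr_ge0// ltW// vmeasure_gt0.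
have : \sum_(1 <= n < N.+1) g n == 0.
  by rewrite eq_le le0/= big_nat_cond sumr_ge0.
rewrite big_nat_cond psumr_eq0// => /allP g0 n nN.
have [A0 AO c0] := A_sub nN; split => //.
have /g0 : n \in index_iota 1 N.+1 by rewrite mem_index_iota.
rewrite nN/= gE// mulf_eq0 subr_eq0 => /predU1P[/eqP|/eqP//].
by rewrite gt_eqF// mulr_gt0 ?vmeasure_gt0.
Qed.

End Coarea.

(** * Uniform estimates and passage to the limit *)

Section Limit.
Context {R : realType} {V : choiceType} (G : weighted_graph R V).

Lemma cvg_sumr (I : Type) (r : seq I) (f : I -> nat -> R) (l : I -> R) :
    (forall i, f i @ \oo --> l i) ->
  (fun k => \sum_(i <- r) f i k) @ \oo --> \sum_(i <- r) l i.
Proof. by move=> fl; apply: cvg_big => [|i _]; [exact: add_continuous|exact: fl]. Qed.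

Lemma normalized_sum Omega p u : 1 < p ->
    normalized_first_eigenfunction G Omega p u ->
  \sum_(x <- Omega) `|u x| `^ p * vwt G x = 1.
Proof.
(* A power equal to 1 also allows a negative base, by convention, or a zero exponent; both are
   excluded. *)
move=> p1 [_ _] /eqP; rewrite /pnorm powR_eq1 => /or3P[/eqP//||].
  by rewrite ltNge sumr_ge0// => x _; rewrite mulr_ge0 ?powR_ge0 ?ltW ?vwt_gt0.
by rewrite invr_eq0 => /eqP; lra.
Qed.

(** A bound independent of [p]: when the modulus exceeds 1 it is at most its [p]-th power, which the
    unit mass bounds by the inverse of [vwt G x]. *)
Lemma normalized_le Omega p u x : 1 < p -> x \in Omega ->
    normalized_first_eigenfunction G Omega p u ->
  `|u x| <= 1 + (vwt G x)^-1.
Proof.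
move=> p1 xO /(normalized_sum p1); rewrite (big_fsetD1 x)//= => ux.
have mu0 := vwt_gt0 G x.
have [u1|/ltW u1] := leP `|u x| 1; first by rewrite ler_wpDr// invr_ge0 ltW.
rewrite ler_wpDl// (le_trans (le1r_powR u1 (ltW p1)))//.
rewrite -div1r ler_pdivlMr// -ux lerDl sumr_ge0// => y _.
by rewrite mulr_ge0 ?powR_ge0 ?ltW ?vwt_gt0.
Qed.

Lemma normalized_energy_le Omega S p u : 1 < p -> Omega != fset0 ->
    contains_nbhd G Omega S -> normalized_first_eigenfunction G Omega p u ->
  edge_sum G S (fun x y => `|u x - u y| `^ p) <= 2 * cheeger G Omega.
Proof.
move=> p1 O0 OS un; have [[lambda _ eigu] u0 _] := un.
rewrite (eigenvalue_energy p1 OS eigu) (normalized_sum p1 un) mulr1.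
by rewrite ler_pM2l// (eigenvalue_le_cheeger p1 OS eigu u0).
Qed.

End Limit.

Theorem theorem0p2 (R : realType) (V : choiceType) (G : weighted_graph R V)
    (Omega : {fset V}) (p : nat -> R) (u : nat -> V -> R) :
  connected_fset G Omega ->
  (forall i, 1 < p i) ->
  p @ \oo --> (1 : R) ->
  (forall i, normalized_first_eigenfunction G Omega (p i) (u i)) ->
  exists (s : nat -> nat) (N : nat) (A : nat -> {fset V}) (c : nat -> R),
    [/\ {homo s : j k / (j < k)%N},
        (1 <= N)%N,
        forall n, (1 <= n <= N)%N -> cheeger_cut G Omega (A n) /\ 0 < c n,
        forall n, (1 <= n < N)%N -> (A n.+1 `<` A n)%fset &
        forall x : V,
          (fun k => u (s k) x) @ \oo -->
            \sum_(1 <= n < N.+1) c n * \1_[set` A n] x].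
Proof.
move=> [nonempty _] p1 pc un.
have [S OS] := contains_nbhd_ex G Omega.
have u_C0 i x : x \notin Omega -> u i x = 0.
  by have [[lambda _ [u0 _ _]] _ _] := un i; exact: u0.
have u_ge0 i x : 0 <= u i x.
  by have [[lambda _ eigu] u0 _] := un i; exact: (eigenfunction_ge0 eigu u0).
have [|s [sinc sc]] := @bolzano_weierstrass_seq R V Omega u.
  move=> x xO; exists (1 + (vwt G x)^-1); split=> [|M ltM k _]; first exact: num_real.
  exact: le_trans (normalized_le (p1 k) xO (un k)) (ltW ltM).
have [U Uc] : {U : V -> R & forall x, (fun k => u (s k) x) @ \oo --> U x}.
  exists (fun x => limn (fun k => u (s k) x)) => x.
  (* Extraction concerned only [Omega]; elsewhere the sequence is constantly 0. *)
  have [/sc//|xO] := boolP (x \in Omega).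
  by under eq_fun do rewrite u_C0//; exact: is_cvg_cst.
have U_ge0 x : 0 <= U x by apply: (cvgr_to_ge (Uc x)); exact: nearW.
have U_C0 : C0 Omega U.
  move=> x xO; have := Uc x. under eq_fun do rewrite u_C0//.
  by move=> /cvg_lim <-//; exact: lim_cst.
have psc : (fun k => p (s k)) @ \oo --> (1 : R).
  exact: (cvg_comp _ _ (increasing_seq_cvgn sinc) pc).
have U_sum : \sum_(x <- Omega) U x * vwt G x = 1.
  have : (fun k => \sum_(x <- Omega) `|u (s k) x| `^ p (s k) * vwt G x) @ \oo
      --> \sum_(x <- Omega) U x * vwt G x.
    apply: cvg_sumr => x; apply: cvgMl; apply: cvg_powR_vary => //.
    by rewrite -[X in _ --> X]ger0_norm//; apply: cvg_norm.
  under eq_fun do rewrite normalized_sum//.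
  by move=> /cvg_lim <-//; rewrite lim_cst.
have U_energy : edge_sum G S (fun x y => `|U x - U y|) <= 2 * cheeger G Omega.
  have : (fun k => edge_sum G S (fun x y => `|u (s k) x - u (s k) y| `^ p (s k)))
      @ \oo --> edge_sum G S (fun x y => `|U x - U y|).
    apply: cvg_sumr => x; apply: cvg_sumr => y; apply: cvgMr.
    apply: cvg_powR_vary => //.
    by apply: cvg_norm; apply: cvgB; exact: Uc.
  move=> /cvgr_to_le; apply; apply: nearW => k.
  exact: normalized_energy_le.
have [N [A [c [A_sub A_proper A_level UE]]]] := layer_cake U_ge0 U_C0.
exists s, N, A, c; split => //.
(* Without layers [U] would vanish, against its unit mass. *)
- rewrite lt0n; apply/eqP => N0.
  have := oner_neq0 R; rewrite -U_sum big1 ?eqxx// => x _.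
  by rewrite UE N0 big_geq// mul0r.
- move=> n nN; have [_ _ c0] := A_sub n nN; split => //.
  (* The mass being 1, [U_energy] is the required reverse Cheeger inequality. *)
  apply: (layers_cheeger_cut OS A_sub A_level UE) => //.
  by rewrite U_sum mulr1.
- move=> x; rewrite (eq_bigr (fun n => c n * (x \in A n)%:R)) -?UE// => n _.
  by rewrite indicE mem_setE.
Qed.
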